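(* The algorithm Find-MDL (defined in the context), run on an input thesaurus tree $T$ with input sample $S$, terminates in time $O(N\times|S|)$, where $N$ denotes the number of leaf nodes in $T$ and $|S|$ denotes the input sample size, and outputs a tree cut model of $T$ with the minimum description length. (The algorithm is written as outputting a cut $\Gamma$; the model output is the tree cut model $M_\Gamma$ with cut $\Gamma$ and parameters estimated from $S$ by maximum likelihood, and minimality means $L(M_\Gamma)\le L(M_{\Gamma'})$ for every cut $\Gamma'$ of $T$.)
   Context: Thesaurus tree. A thesaurus is a tree $T$ in which each leaf node stands for a noun, each internal node represents a noun class, and domination stands for set inclusion. A node $C$ is viewed as representing the set of all leaf nodes it dominates (a leaf represents itself), and $|C|$ is the number of these leaves. A cut of $T$ is any set $\Gamma$ of nodes of $T$ that defines a partition of the leaf nodes of $T$; cuts of subtrees are defined in the same way. The sample $S$ is a finite multiset of nouns that are leaves of $T$, and $|S|$ is its size counted with multiplicity. Tree cut model. A tree cut model is a cut $\Gamma$ together with a probability parameter $P(C)$ for each $C\in\Gamma$, the parameters summing to one; it assigns each noun $n\in C$ the probability $P(C)/|C|$. The parameters are estimated from $S$ by maximum likelihood: with $f(C)$ the total frequency in $S$ of nouns in $C$, $$\hat P(C)=\frac{f(C)}{|S|}\quad\text{for } C\in\Gamma,\qquad \hat P(n)=\frac{1}{|C|}\hat P(C)\quad\text{for } n\in C\in\Gamma .$$ $M_\Gamma$ denotes the tree cut model with cut $\Gamma$ and these parameters. Description length. All logarithms are to base 2. For a cut $\Gamma$ of $T$, $$L(M_\Gamma)=L_{mod}(M_\Gamma)+L_{par}(M_\Gamma)+L_{dat}(M_\Gamma),$$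 where $L_{mod}(M_\Gamma)=\log|\mathcal G|$ with $\mathcal G$ the set of all cuts of $T$ (the same for every cut); $L_{par}(M_\Gamma)=\frac{K}{2}\log|S|$ with $K=|\Gamma|-1$ the number of free parameters; and $L_{dat}(M_\Gamma)=-\sum_{n\in S}\log\hat P(n)$, the sum being over elements of $S$ with multiplicity. Quantity used by the algorithm. For a subtree $t$ of $T$ (a node of $T$ together with all its descendants, possibly $t=T$) and a cut $c$ of $t$, put $$L'(c)=\frac{|c|}{2}\log|S|-\sum_{n\in S,\ n\text{ a leaf of }t}\log\hat P(n),$$ where $\hat P(n)=\frac{1}{|C|}\frac{f(C)}{|S|}$ for $n\in C\in c$, and $|S|$ is always the size of the whole sample. (The number of nodes $|c|$ of the current cut is used in the first term both when $t$ is a proper subtree and when $t=T$, although for $t=T$ the number of free parameters is $|c|-1$.) Algorithm Find-MDL$(t)$, initially called with $t=T$: if $t$ is a leaf node, return the cut $[t]$. Otherwise, for each child subtree $t_i$ of $t$ compute $c_i:=$ Find-MDL$(t_i)$, and let $c$ be the result of appending all the $c_i$. If $L'([\mathrm{root}(t)])<L'(c)$, return $[\mathrm{root}(t)]$; otherwise return $c$. Here $\mathrm{root}(t)$ is the root node of $t$.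
   Formalization: The O(N×|S|) time bound is proved only for trees in which every internal node has at least two children, since it fails for a long chain of one-child nodes above a single leaf; the sample is taken to be nonempty. *)

(* Defs.v *)
From HB Require Import structures.
From mathcomp Require Import all_boot all_order all_algebra finmap.
From mathcomp Require Import reals exp.

Set Implicit Arguments.
Unset Strict Implicit.
Unset Printing Implicit Defensive.

Import Order.TTheory GRing.Theory Num.Theory.
Local Open Scope fset_scope.
Local Open Scope ring_scope.

Inductive tree (noun : Type) : Type :=
  | Leaf of noun
  | Node of seq (tree noun).

Arguments Leaf {noun} _.
Arguments Node {noun} _.

Fixpoint encode_tree (noun : Type) (t : tree noun) : GenTree.tree noun :=
  match t with
  | Leaf n => GenTree.Leaf n
  | Node ts => GenTree.Node 0 (map (@encode_tree noun) ts)
  end.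

Fixpoint decode_tree (noun : Type) (t : GenTree.tree noun) : tree noun :=
  match t with
  | GenTree.Leaf n => Leaf n
  | GenTree.Node _ ts => Node (map (@decode_tree noun) ts)
  end.

Fixpoint encode_treeK (noun : Type) (t : tree noun) :
  decode_tree (encode_tree t) = t :=
  match t with
  | Leaf n => erefl
  | Node ts =>
      congr1 Node
        ((fix loop (s : seq (tree noun)) :
            map (@decode_tree noun) (map (@encode_tree noun) s) = s :=
            match s with
            | [::] => erefl
            | x :: s' => congr2 cons (encode_treeK x) (loop s')
            end) ts)
  end.

HB.instance Definition _ (noun : choiceType) :=
  Choice.copy (tree noun) (can_type (@encode_treeK noun)).

(* The nouns at the leaves, from left to right. *)
Fixpoint leaves (noun : Type) (t : tree noun) : seq noun :=
  match t with
  | Leaf n => [:: n]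
  | Node ts => flatten (map (@leaves noun) ts)
  end.

(* A node is represented by the subtree hanging from it, so that root(t) is t
   itself. This is unambiguous in a thesaurus tree: there, distinct positions
   carry distinct subtrees, because the leaves are pairwise distinct and every
   node dominates at least one of them. *)
Fixpoint nodes (noun : Type) (t : tree noun) : seq (tree noun) :=
  t :: match t with
       | Leaf _ => [::]
       | Node ts => flatten (map (@nodes noun) ts)
       end.

Definition arity_ge (noun : Type) (d : nat) (T : tree noun) : bool :=
  all (fun t => if t is Node ts then (d <= size ts)%N else true) (nodes T).

(* [Node [::]] is neither a leaf nor an internal node, hence the arity
   condition; unary internal nodes are allowed. *)
Definition thesaurus (noun : eqType) (T : tree noun) : bool :=
  uniq (leaves T) && arity_ge 1 T.

(* No unary internal nodes: distinct nodes are distinct noun classes. *)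
Definition branching (noun : Type) (T : tree noun) : bool := arity_ge 2 T.

Definition class (noun : choiceType) (C : tree noun) : {fset noun} :=
  [fset n in leaves C].

Definition is_cut (noun : choiceType) (t : tree noun)
    (c : {fset tree noun}) : bool :=
  [&& c `<=` [fset C in nodes t],
      all (fun C => class C != fset0) c,
      pairwise (fun C D => [disjoint class C & class D]) c
    & \bigcup_(C <- c) class C == class t].

Definition cuts (noun : choiceType) (T : tree noun) : {fset {fset tree noun}} :=
  [fset c in fpowerset [fset C in nodes T] | is_cut T c].

(* Values of [param] outside [cut] are irrelevant. *)
Record tcm (R : realType) (noun : choiceType) :=
  TCM { cut : {fset tree noun}; param : tree noun -> R }.

Definition is_tree_cut_model (R : realType) (noun : choiceType)
    (T : tree noun) (M : tcm R noun) : Prop :=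
  [/\ is_cut T (cut M), forall C, C \in cut M -> 0 <= param M C
    & \sum_(C <- cut M) param M C = 1].

(* The class of n in c; the default is never used when c is a cut of a tree
   having n as a leaf. *)
Definition class_of (noun : choiceType) (c : {fset tree noun}) (n : noun) :
  tree noun := head (Leaf n) [seq C <- c | n \in class C].

Definition noun_prob (R : realType) (noun : choiceType) (M : tcm R noun)
    (n : noun) : R :=
  let C := class_of (cut M) n in param M C / #|` class C|%:R.

(* A sample is the list of its elements, repeated according to multiplicity. *)
Definition freq (noun : choiceType) (S : seq noun) (C : tree noun) : nat :=
  count (fun n => n \in class C) S.

Definition mle (R : realType) (noun : choiceType) (S : seq noun)
    (c : {fset tree noun}) : tcm R noun :=
  TCM c (fun C => (freq S C)%:R / (size S)%:R).

Definition log2 (R : realType) (x : R) : R := ln x / ln 2.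

Definition L_mod (R : realType) (noun : choiceType) (T : tree noun) : R :=
  log2 #|` cuts T|%:R.

Definition L_par (R : realType) (noun : choiceType) (S : seq noun)
    (M : tcm R noun) : R :=
  (#|` cut M|%:R - 1) / 2 * log2 (size S)%:R.

Definition L_dat (R : realType) (noun : choiceType) (S : seq noun)
    (M : tcm R noun) : R :=
  - \sum_(n <- S) log2 (noun_prob M n).

Definition description_length (R : realType) (noun : choiceType)
    (T : tree noun) (S : seq noun) (M : tcm R noun) : R :=
  L_mod R T + L_par S M + L_dat S M.

Definition L' (R : realType) (noun : choiceType) (S : seq noun)
    (t : tree noun) (c : {fset tree noun}) : R :=
  #|` c|%:R / 2 * log2 (size S)%:R
  - \sum_(n <- S | n \in class t) log2 (noun_prob (mle R S c) n).

Fixpoint find_mdl (R : realType) (noun : choiceType) (S : seq noun)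
    (t : tree noun) : {fset tree noun} :=
  match t with
  | Leaf _ => [fset t]
  | Node ts =>
      let c := \bigcup_(ci <- map (find_mdl R S) ts) ci in
      if L' R S t [fset t] < L' R S t c then [fset t] else c
  end.

(* Running time. [find_mdl_timed] is Find-MDL written out as a program on a
   unit-cost machine with exact real arithmetic; a [timed A] is a result
   together with the number of steps spent. One [step] pays for a bounded number
   of elementary operations: arithmetic operations, logarithms and comparisons
   of numbers, an equality test between nouns, the allocation of a record or
   list cell, or the concatenation of two lists (linked lists with a pointer to
   the last cell; no list is concatenated twice). Every loop below pays for its
   iterations. *)
Definition timed (A : Type) : Type := (A * nat)%type.

Definition ret (A : Type) (x : A) : timed A := (x, 0%N).

Definition step (A : Type) (x : A) : timed A := (x, 1%N).

Definition bind (A B : Type) (m : timed A) (f : A -> timed B) : timed B :=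
  let r := f m.1 in (r.1, (m.2 + r.2)%N).

Definition result (A : Type) (m : timed A) : A := m.1.

Definition time (A : Type) (m : timed A) : nat := m.2.

Notation "x <-- m ;; k" := (bind m (fun x => k))
  (at level 100, m at next level, right associativity).

Definition map_timed (A B : Type) (f : A -> timed B) : seq A -> timed (seq B) :=
  fix loop s :=
    if s is x :: s' then
      y <-- f x ;; ys <-- loop s' ;; step (y :: ys)
    else step [::].

Fixpoint size_timed (A : Type) (s : seq A) : timed nat :=
  if s is _ :: s' then k <-- size_timed s' ;; step k.+1 else step 0%N.

Fixpoint nseq_timed (A : Type) (k : nat) (x : A) : timed (seq A) :=
  if k is k'.+1 then s <-- nseq_timed k' x ;; step (x :: s) else step [::].

Fixpoint count_timed (noun : eqType) (n : noun) (s : seq noun) : timed nat :=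
  if s is m :: s' then
    k <-- count_timed n s' ;;
    b <-- step (m == n) ;;
    step (if b then k.+1 else k)
  else step 0%N.

Fixpoint sum_log_timed (R : realType) (ps : seq R) : timed R :=
  if ps is p :: ps' then
    s <-- sum_log_timed ps' ;; l <-- step (log2 p) ;; step (l + s)
  else step 0.

(* What a call on t returns: the cut c, its number of nodes, the number of
   leaves of t, and the list of the probabilities P^(n) under c of the elements
   n of S that are leaves of t, with multiplicity. *)
Record answer (R : realType) (noun : Type) := Answer {
  ans_cut : seq (tree noun);
  ans_size : nat;
  ans_leaves : nat;
  ans_probs : seq R }.

Fixpoint append_timed (R : realType) (noun : Type)
    (rs : seq (answer R noun)) : timed (answer R noun) :=
  if rs is r :: rs' then
    a <-- append_timed rs' ;;
    c <-- step (ans_cut r ++ ans_cut a) ;;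
    k <-- step (ans_size r + ans_size a)%N ;;
    m <-- step (ans_leaves r + ans_leaves a)%N ;;
    ps <-- step (ans_probs r ++ ans_probs a) ;;
    step (Answer c k m ps)
  else step (Answer [::] 0 0 [::]).

(* L' of a cut with k nodes that gives the probabilities ps to the relevant
   elements of the sample; lS is log |S|. *)
Definition L'_timed (R : realType) (lS : R) (k : nat) (ps : seq R) : timed R :=
  s <-- sum_log_timed ps ;; step (k%:R / 2 * lS - s).

Fixpoint visit_timed (R : realType) (noun : eqType) (S : seq noun)
    (sS : nat) (lS : R) (t : tree noun) : timed (answer R noun) :=
  match t with
  | Leaf n =>
      f <-- count_timed n S ;;
      p <-- step (f%:R / sS%:R) ;;
      ps <-- nseq_timed f p ;;
      step (Answer [:: t] 1 1 ps)
  | Node ts =>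
      rs <-- map_timed (visit_timed S sS lS) ts ;;
      a <-- append_timed rs ;;
      f <-- size_timed (ans_probs a) ;;
      p <-- step (f%:R / sS%:R / (ans_leaves a)%:R) ;;
      ps <-- nseq_timed f p ;;
      l_root <-- L'_timed lS 1 ps ;;
      l_c <-- L'_timed lS (ans_size a) (ans_probs a) ;;
      b <-- step (l_root < l_c) ;;
      if b then step (Answer [:: t] 1 (ans_leaves a) ps) else step a
  end.

Definition find_mdl_timed (R : realType) (noun : eqType) (S : seq noun)
    (T : tree noun) : timed (seq (tree noun)) :=
  sS <-- size_timed S ;;
  lS <-- step (log2 (sS%:R : R)) ;;
  a <-- visit_timed S sS lS T ;;
  step (ans_cut a).

(* Main.v *)
Require Import Defs.
From mathcomp Require Import all_boot all_order all_algebra finmap.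
From mathcomp Require Import reals exp.
From mathcomp Require Import ring zify.

Set Implicit Arguments.
Unset Strict Implicit.
Unset Printing Implicit Defensive.

Import Order.TTheory GRing.Theory Num.Theory.
Local Open Scope ring_scope.

(* Grouping the sample by the classes of a cut turns L' into a sum over the cut
   of a cost that depends on the class alone. A cut of t is either {t} or a
   disjoint union of cuts of the children of t, so choosing the cheaper of {t}
   and the union of optimal cuts of the children is optimal, by induction on t.
   On cuts of T, L' differs from the description length by a constant.
   An internal node with k children takes O(k + |S|) steps, and when k >= 2 at
   every internal node the sum of the k's is at most twice the number of leaves. *)

(** * Concatenations of disjoint lists, and induction on trees *)

Lemma uniq_flatten_map_inj (A B : eqType) (f : A -> seq B) (s : seq A)
    (a a' : A) (x : B) :
  uniq (flatten (map f s)) -> a \in s -> a' \in s ->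
  x \in f a -> x \in f a' -> a = a'.
Proof.
elim: s => //= b s IHs; rewrite cat_uniq => /and3P[_ /hasPn disj uniq_s].
rewrite !inE => /orP[/eqP-> | as_] /orP[/eqP-> | a's] // xa xa'.
- by have /disj/negP[] : x \in flatten (map f s) by apply/flatten_mapP; exists a'.
- by have /disj/negP[] : x \in flatten (map f s) by apply/flatten_mapP; exists a.
- exact: IHs.
Qed.

(* w assigns to x a nonempty list of witnesses in g a for x being in f a: since
   the g a are disjoint, so are the f a. *)
Lemma uniq_flatten_map (A B D : eqType) (f : A -> seq B) (g : A -> seq D)
    (w : B -> seq D) (s : seq A) :
  (forall a, a \in s -> uniq (f a)) ->
  (forall a x, a \in s -> x \in f a -> w x != [::] /\ {subset w x <= g a}) ->
  uniq (flatten (map g s)) -> uniq (flatten (map f s)).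
Proof.
elim: s => //= b s IHs uf wP; rewrite !cat_uniq => /and3P[_ /hasPn disj uniq_s].
rewrite uf ?mem_head //= IHs ?andbT //; first last.
- by move=> a x as_; apply: wP; rewrite inE as_ orbT.
- by move=> a as_; apply: uf; rewrite inE as_ orbT.
apply/hasPn => x /flatten_mapP[a as_ xa]; apply/negP => /= xb.
have [wx0 wxb] := wP b x (mem_head _ _) xb.
have [_ wxa] : w x != [::] /\ {subset w x <= g a}.
  by apply: wP; rewrite // inE as_ orbT.
case: (w x) wx0 wxb wxa => // y r _ wxb wxa.
have /disj/negP[] : y \in flatten (map g s).
  by apply/flatten_mapP; exists a; rewrite ?wxa ?mem_head.
by rewrite /= wxb ?mem_head.
Qed.

Lemma perm_flatten_map (A B : eqType) (f g : A -> seq B) (s : seq A) :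
  (forall a, a \in s -> perm_eq (f a) (g a)) ->
  perm_eq (flatten (map f s)) (flatten (map g s)).
Proof.
elim: s => //= a s IHs fg; rewrite perm_cat ?fg ?mem_head // IHs // => b bs.
by rewrite fg // inE bs orbT.
Qed.

(** The induction principle generated for [tree] gives no hypothesis on the subtrees inside the list
    of children; this one does. *)
Lemma tree_ind_in (noun : choiceType) (P : tree noun -> Prop) :
  (forall n, P (Leaf n)) ->
  (forall ts, (forall t, t \in ts -> P t) -> P (Node ts)) ->
  forall t, P t.
Proof.
move=> PL PN; fix IH 1 => -[n | ts]; first exact: PL.
(* [IH] is cleared before a goal is closed automatically: applied to a tree not known to be a
   subterm, it would violate the guard condition. *)
apply: PN; elim: ts => [u | t ts IHts u]; first by clear IH; rewrite in_nil.
by rewrite inE => /orP[/eqP-> | /IHts {IH} //]; exact: IH.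
Qed.

(** * Nodes, leaves and cuts of a thesaurus tree *)

Section Trees.
Variable noun : choiceType.
Implicit Types (t u C D : tree noun) (ts : seq (tree noun)).

Lemma arity_ge_Node d ts :
  arity_ge d (Node ts) = (d <= size ts)%N && all (arity_ge d) ts.
Proof.
rewrite /arity_ge /=; congr andb.
by elim: ts => //= t ts IHts; rewrite all_cat IHts.
Qed.

Lemma thesaurus_child ts t :
  thesaurus (Node ts) -> t \in ts -> thesaurus t.
Proof.
rewrite /thesaurus arity_ge_Node => /and3P[U _ /allP arity] tts.
rewrite arity // andbT; elim: ts tts U {arity} => //= u ts IHts.
by rewrite inE cat_uniq => /orP[/eqP-> /and3P[]| /IHts IH /and3P[_ _ /IH]].
Qed.

Lemma node_root t : t \in nodes t.
Proof. by case: t => *; exact: mem_head. Qed.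

Lemma leaves_neq0 t : thesaurus t -> leaves t != [::].
Proof.
elim/tree_ind_in: t => // -[|t ts] IH th.
  by move: th; rewrite /thesaurus arity_ge_Node andbF.
have := IH t (mem_head _ _) (thesaurus_child th (mem_head _ _)).
by rewrite /=; case: (leaves t).
Qed.

Lemma thesaurus_node t u : thesaurus t -> u \in nodes t -> thesaurus u.
Proof.
elim/tree_ind_in: t => [n | ts IH] th; rewrite /= inE.
  by move=> /eqP->.
case/orP=> [/eqP-> // | /flatten_mapP[t tts]].
by apply: IH => //; apply: thesaurus_child tts.
Qed.

Lemma leaves_node t u : u \in nodes t -> {subset leaves u <= leaves t}.
Proof.
elim/tree_ind_in: t => [n | ts IH]; rewrite /= inE.
  by move=> /eqP->.
case/orP=> [/eqP-> // | /flatten_mapP[t tts ut] n nu].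
by apply/flatten_mapP; exists t => //; apply: IH nu.
Qed.

Lemma size_nodes_node t u : u \in nodes t -> (size (nodes u) <= size (nodes t))%N.
Proof.
elim/tree_ind_in: t => [n | ts IH]; rewrite /= inE.
  by move=> /eqP->.
case/orP=> [/eqP-> // | /flatten_mapP[t tts ut]].
apply: leq_trans (IH t tts ut) (leqW _).
elim: ts tts {IH} => //= v ts IHts; rewrite inE size_cat.
by case/orP=> [/eqP-> | /IHts]; lia.
Qed.

(** The root has strictly more nodes below or equal to it than any child has, whereas a node of a
    child has at most as many as that child. *)
Lemma root_notin_child_nodes ts t : t \in ts -> Node ts \notin nodes t.
Proof.
move=> tts; apply/negP => /size_nodes_node /=; apply/negP; rewrite -ltnNge ltnS.
elim: ts tts => //= v ts IHts; rewrite inE size_cat.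
by case/orP=> [/eqP-> | /IHts]; lia.
Qed.

(** A node shared by two children would place its leaves, of which there is at least one, under
    both. *)
Lemma uniq_nodes_children ts :
  thesaurus (Node ts) -> (forall t, t \in ts -> uniq (nodes t)) ->
  uniq (flatten (map (@nodes noun) ts)).
Proof.
move=> th U; apply: (uniq_flatten_map (g := @leaves noun) (w := @leaves noun)).
- exact: U.
- move=> t u tts ut; split; last exact: leaves_node.
  exact/leaves_neq0/(thesaurus_node (thesaurus_child th tts)).
- by case/andP: th.
Qed.

Lemma uniq_nodes t : thesaurus t -> uniq (nodes t).
Proof.
elim/tree_ind_in: t => // ts IH th /=; rewrite uniq_nodes_children // ?andbT.
  apply/flatten_mapP => -[t tts]; apply/negP; exact: root_notin_child_nodes.
by move=> t tts; apply: IH (tts) (thesaurus_child th tts).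
Qed.

(** Working form of [is_cut]: every leaf lies under exactly one member. It is stated for lists, so
    that concatenation and filtering apply; repetitions are allowed, and [uniq] is carried
    separately. *)
Definition leaf_partition t (c : seq (tree noun)) : Prop :=
  {subset c <= nodes t} /\
  forall n, n \in leaves t ->
    exists2 C, C \in c /\ n \in leaves C
             & forall D, D \in c -> n \in leaves D -> D = C.

Lemma in_class t n : (n \in class t) = (n \in leaves t).
Proof. by rewrite inE. Qed.

Lemma is_cutP t (c : {fset tree noun}) :
  thesaurus t -> reflect (leaf_partition t c) (is_cut t c).
Proof.
move=> th; apply: (iffP and4P) => [[/fsubsetP cn _ cpw /eqP cov] | [cn part]].
  have {}cn : {subset c <= nodes t} by move=> C /cn; rewrite inE.
  split=> // n; rewrite -in_class -cov => /bigfcupP[C]; rewrite andbT in_class.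
  move=> Cc nC; exists C => // D Dc nD; apply/eqP; apply: contraTT cpw => DC.
  apply/negP => /(pairwiseP (Leaf n)) pw.
  (* [pairwise] only relates an earlier position to a later one; disjointness is symmetric, so any
     two distinct positions will do. *)
  have sym i j : (i < size c)%N -> (j < size c)%N -> i != j ->
      [disjoint class (nth (Leaf n) c i) & class (nth (Leaf n) c j)]%fset.
    move=> ic jc; rewrite neq_ltn => /orP[] ij; first exact: pw.
    by rewrite fdisjoint_sym; exact: pw.
  have ij : index D c != index C c by apply: contra DC => /eqP/index_inj->.
  have := sym (index D c) (index C c).
  rewrite !index_mem !nth_index // => /(_ Dc Cc ij)/fdisjointP/(_ n).
  by rewrite !in_class nD nC => /(_ isT).
split.
- by apply/fsubsetP => C /cn; rewrite inE.
- apply/allP => C /cn /(thesaurus_node th)/leaves_neq0 C0.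
  case E: (leaves C) C0 => [//|n s] _; apply/fset0Pn; exists n.
  by rewrite in_class E mem_head.
(* A leaf common to the classes at two positions forces the nodes there to be equal, which the
   absence of repetitions in [c] excludes. *)
- apply/(pairwiseP (Node [::])) => i j ic jc ij; apply/fdisjointP => n.
  rewrite !in_class => ni; apply/negP => nj.
  have ci := mem_nth (Node [::]) ic; have cj := mem_nth (Node [::]) jc.
  have [C _ uC] := part n (leaves_node (cn _ ci) ni).
  have /eqP := etrans (uC _ ci ni) (esym (uC _ cj nj)).
  by rewrite nth_uniq ?fset_uniq // ltn_eqF.
- apply/eqP/fsetP => n; rewrite in_class; apply/bigfcupP/idP.
    case=> C; rewrite andbT in_class => Cc; exact/leaves_node/cn.
  by move=> /part[C [Cc nC] _]; exists C; rewrite ?Cc ?in_class.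
Qed.

Lemma leaf_partition_root t : leaf_partition t [:: t].
Proof.
split=> [C | n nt]; first by rewrite inE => /eqP->; exact: node_root.
by exists t; [rewrite mem_head | move=> D; rewrite inE => /eqP].
Qed.

Lemma leaf_partition_flatten ts (f : tree noun -> seq (tree noun)) :
  thesaurus (Node ts) -> (forall t, t \in ts -> leaf_partition t (f t)) ->
  leaf_partition (Node ts) (flatten (map f ts)).
Proof.
move=> /andP[U _] fP; split=> [C /flatten_mapP[t tts Ct] | n].
  rewrite /= inE; apply/orP; right; apply/flatten_mapP; exists t => //.
  by have [sub _] := fP t tts; apply: sub.
case/flatten_mapP=> t tts nt; have [_ /(_ n nt)[C [Ct nC] uC]] := fP t tts.
exists C => [|D /flatten_mapP[u uts Du] nD].
  by split=> //; apply/flatten_mapP; exists t.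
(* [C] lies under [t] and [D] under [u], and both dominate [n]; since distinct children share no
   leaf, uniqueness within [t] applies. *)
apply: uC => //; suff -> : t = u by [].
apply: (uniq_flatten_map_inj U tts uts nt).
by have [sub _] := fP u uts; apply: leaves_node nD; apply: sub.
Qed.

(** Each member dominates some leaf, which [t] dominates as well, so the member is [t]. *)
Lemma leaf_partition_with_root t (c : seq (tree noun)) :
  thesaurus t -> leaf_partition t c -> uniq c -> t \in c -> c = [:: t].
Proof.
move=> th [cn part] uc tc; apply/perm_small_eq => //; apply: uniq_perm => // C.
rewrite inE; apply/idP/eqP => [Cc | -> //].
have [n nC] : exists n, n \in leaves C.
  have := leaves_neq0 (thesaurus_node th (cn C Cc)).
  by case: (leaves C) => // n s _; exists n; rewrite mem_head.
have nt : n \in leaves t := leaves_node (cn C Cc) nC.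
by have [D _ uD] := part n nt; rewrite (uD C) // (uD t).
Qed.

Definition restrict (c : seq (tree noun)) t := [seq C <- c | C \in nodes t].

(** The member above a leaf of [t] is not the root, so it lies inside some child; that child shares
    a leaf with [t] and hence is [t]. *)
Lemma leaf_partition_restrict ts (c : seq (tree noun)) t :
  thesaurus (Node ts) -> leaf_partition (Node ts) c -> Node ts \notin c ->
  t \in ts -> leaf_partition t (restrict c t).
Proof.
move=> /andP[U _] [cn part] rc tts; split=> [C | n nt].
  by rewrite mem_filter => /andP[].
have [|C [Cc nC] uC] := part n; first by apply/flatten_mapP; exists t.
exists C => [|D]; last by rewrite mem_filter => /andP[_]; exact: uC.
split=> //; rewrite mem_filter Cc andbT.
have := cn C Cc; rewrite /= inE => /orP[/eqP Cr | /flatten_mapP[u uts Cu]].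
  by rewrite -Cr Cc in rc.
suff -> : t = u by [].
by apply: (uniq_flatten_map_inj U tts uts nt); apply: leaves_node nC.
Qed.

(** With the previous lemma, this splits a cut other than the root into cuts of the children. The
    pieces do not overlap because distinct children have no node in common. *)
Lemma perm_restrict ts (c : seq (tree noun)) :
  thesaurus (Node ts) -> leaf_partition (Node ts) c -> Node ts \notin c ->
  uniq c -> perm_eq c (flatten (map (restrict c) ts)).
Proof.
move=> th [cn _] rc uc; apply: uniq_perm => // [|C].
  apply: (uniq_flatten_map (g := @nodes noun) (w := fun C => [:: C])).
  - by move=> t _; rewrite filter_uniq.
  - move=> t C _; rewrite mem_filter => /andP[Ct _]; split=> // D.
    by rewrite inE => /eqP->.
  - by apply: uniq_nodes_children => // t /(thesaurus_child th)/uniq_nodes.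
apply/idP/flatten_mapP => [Cc | [t _]]; last by rewrite mem_filter => /andP[].
have := cn C Cc; rewrite /= inE => /orP[/eqP Cr | /flatten_mapP[u uts Cu]].
  by rewrite -Cr Cc in rc.
by exists u; rewrite // mem_filter Cu.
Qed.

Lemma uniq_flatten_partition ts (f : tree noun -> seq (tree noun)) :
  thesaurus (Node ts) ->
  (forall t, t \in ts -> uniq (f t)) ->
  (forall t, t \in ts -> leaf_partition t (f t)) ->
  uniq (flatten (map f ts)).
Proof.
move=> th uf fP.
apply: (uniq_flatten_map (g := @nodes noun) (w := fun C => [:: C])) => //.
  move=> t C tts Ct; split=> // D.
  by rewrite inE => /eqP->; have [sub _] := fP t tts; apply: sub.
by apply: uniq_nodes_children => // t /(thesaurus_child th)/uniq_nodes.
Qed.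

End Trees.

(** * Additivity of the description length and optimality of Find-MDL *)

Section DescriptionLength.
Variables (R : realType) (noun : choiceType) (S : seq noun).
Implicit Types (t C D : tree noun) (ts : seq (tree noun)).

Lemma class_of_eq (c : {fset tree noun}) C n :
  C \in c -> n \in leaves C ->
  (forall D, D \in c -> n \in leaves D -> D = C) -> class_of c n = C.
Proof.
move=> Cc nC uC; rewrite /class_of.
have : C \in [seq D <- c | n \in class D] by rewrite mem_filter in_class nC.
case E: [seq D <- c | n \in class D] => [//|D s] _ /=.
have : D \in [seq D <- c | n \in class D] by rewrite E mem_head.
by rewrite mem_filter in_class => /andP[nD Dc]; apply: uC.
Qed.

(** Double counting of the pairs of a sample element and a class containing it: an element under [t]
    has exactly one such class, any other element none. The codomain is general so that both natural
    and real weights are covered. *)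
Lemma sum_class_of (V : nmodType) t (c : {fset tree noun}) (g : tree noun -> V) :
  leaf_partition t c ->
  \sum_(n <- S | n \in class t) g (class_of c n)
    = \sum_(C <- c) g C *+ freq S C.
Proof.
move=> [cn part].
have -> : \sum_(C <- c) g C *+ freq S C
    = \sum_(n <- S) \sum_(C <- c | n \in class C) g C.
  rewrite (exchange_big_dep xpredT) //=; apply: eq_bigr => C _.
  by rewrite big_const_seq iter_addr_0.
rewrite big_mkcond; apply: eq_bigr => n _; rewrite in_class.
case: ifP => [nt | /negP nt].
  have [C [Cc nC] uC] := part n nt; rewrite (class_of_eq Cc nC uC).
  rewrite big_seq_cond (eq_bigl (pred1 C)) => [|D /=].
    by rewrite -big_filter filter_pred1_uniq ?fset_uniq // big_seq1.
  rewrite in_class; apply/andP/eqP => [[Dc nD] | -> //]; exact: uC.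
rewrite big_seq_cond big1 // => C /andP[Cc]; rewrite in_class => nC.
by case: nt; apply: leaves_node nC; apply: cn.
Qed.

Lemma sum_freq t (c : {fset tree noun}) :
  leaf_partition t c -> (\sum_(C <- c) freq S C = freq S t)%N.
Proof.
move=> cP; rewrite [RHS]/freq -sum1_count.
rewrite [RHS](sum_class_of (fun=> 1%N : nat) cP); apply: eq_bigr => C _.
by rewrite natn.
Qed.

(** The estimated probability of each noun of [C], which depends on a cut containing [C] only
    through [C]. If [freq S C] is zero, its logarithm enters [cost] with multiplicity zero, so the
    value of [log2] at 0 is harmless. *)
Definition class_prob C : R :=
  (freq S C)%:R / (size S)%:R / #|` class C|%:R.

(* The contribution of a single class to L': minimizing L' over the cuts means
   minimizing an additive functional of the classes. *)
Definition cost C : R :=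
  log2 (size S)%:R / 2 - log2 (class_prob C) *+ freq S C.

Lemma L'_sum_cost t (c : {fset tree noun}) :
  leaf_partition t c -> L' R S t c = \sum_(C <- c) cost C.
Proof.
move=> cP; rewrite /L' sumrB.
rewrite (sum_class_of (fun C => log2 (class_prob C)) cP); congr (_ - _).
by rewrite big_const_seq count_predT iter_addr_0 -[RHS]mulr_natl; ring.
Qed.

Lemma find_mdl_Node ts :
  find_mdl R S (Node ts) =
    let c := (\bigcup_(t <- ts) find_mdl R S t)%fset in
    if L' R S (Node ts) [fset Node ts]%fset < L' R S (Node ts) c
    then [fset Node ts]%fset else c.
Proof. by rewrite /= big_map. Qed.

(** Cuts of distinct children are disjoint, so their union loses nothing against concatenation, and
    sums over it split along the children. *)
Lemma perm_bigfcup_flatten ts (f : tree noun -> {fset tree noun}) :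
  thesaurus (Node ts) -> (forall t, t \in ts -> leaf_partition t (f t)) ->
  perm_eq (\bigcup_(t <- ts) f t)%fset
    (flatten [seq enum_fset (f t) | t <- ts]).
Proof.
move=> th fP; apply: uniq_perm => //.
  by apply: (uniq_flatten_partition th) => // t _; apply: fset_uniq.
move=> C; apply/bigfcupP/flatten_mapP => -[t tts Ct]; exists t => //.
  by case/andP: tts.
by rewrite tts.
Qed.

Lemma eq_mem_leaf_partition t (c c' : seq (tree noun)) :
  c =i c' -> leaf_partition t c -> leaf_partition t c'.
Proof.
move=> cc' [sub part]; split=> [C | n /part[C [Cc nC] uC]].
  by rewrite -cc'; apply: sub.
by exists C => [|D]; rewrite -cc' //; apply: uC.
Qed.

Lemma leaf_partition_bigfcup ts (f : tree noun -> {fset tree noun}) :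
  thesaurus (Node ts) -> (forall t, t \in ts -> leaf_partition t (f t)) ->
  leaf_partition (Node ts) (\bigcup_(t <- ts) f t)%fset.
Proof.
move=> th fP; apply: eq_mem_leaf_partition (leaf_partition_flatten th fP) => C.
by rewrite (perm_mem (perm_bigfcup_flatten th fP)).
Qed.

Lemma leaf_partition_fset1 t : leaf_partition t [fset t]%fset.
Proof.
by apply: eq_mem_leaf_partition (leaf_partition_root t) => C; rewrite !inE.
Qed.

Lemma find_mdl_partition t :
  thesaurus t -> leaf_partition t (find_mdl R S t).
Proof.
elim/tree_ind_in: t => [n | ts IH] th; first exact: leaf_partition_fset1.
rewrite find_mdl_Node /=; case: ifP => _; first exact: leaf_partition_fset1.
by apply: leaf_partition_bigfcup => // t tts; apply: IH (thesaurus_child th tts).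
Qed.

Lemma perm_flatten_find_mdl ts (f : tree noun -> seq (tree noun)) :
  thesaurus (Node ts) ->
  (forall t, t \in ts -> perm_eq (f t) (find_mdl R S t)) ->
  perm_eq (flatten (map f ts)) (\bigcup_(t <- ts) find_mdl R S t)%fset.
Proof.
move=> th perm; apply: perm_trans (perm_flatten_map perm) _.
rewrite perm_sym; apply: perm_bigfcup_flatten => // t tts.
exact/find_mdl_partition/(thesaurus_child th).
Qed.

Lemma find_mdl_min t (c : seq (tree noun)) :
  thesaurus t -> leaf_partition t c -> uniq c ->
  \sum_(C <- find_mdl R S t) cost C <= \sum_(C <- c) cost C.
Proof.
elim/tree_ind_in: t c => [n | ts IH] c th cP uc.
  rewrite (leaf_partition_with_root th cP uc) ?big_seq_fset1 ?big_seq1 //.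
  have [sub part] := cP; have [C [Cc _] _] := part n (mem_head _ _).
  by have := sub C Cc; rewrite inE => /eqP <-.
have fP t : t \in ts -> leaf_partition t (find_mdl R S t).
  by move=> tts; apply/find_mdl_partition/(thesaurus_child th).
rewrite find_mdl_Node /=; set c0 := (\bigcup_(t <- ts) _)%fset.
have c0P : leaf_partition (Node ts) c0 by apply: leaf_partition_bigfcup.
rewrite (L'_sum_cost (leaf_partition_fset1 _)) (L'_sum_cost c0P) big_seq_fset1.
have [rc | rc] := boolP (Node ts \in c).
  rewrite (leaf_partition_with_root th cP uc) // big_seq1.
  by case: ltP; rewrite ?big_seq_fset1.
(* The returned cut never costs more than [c0], so the root option needs no further comparison with
   [c]. *)
suff c0c : \sum_(C <- c0) cost C <= \sum_(C <- c) cost C.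
  by case: ltP => // lt; rewrite big_seq_fset1 (le_trans (ltW lt)).
rewrite (perm_big _ (perm_restrict th cP rc uc)).
rewrite (perm_big _ (perm_bigfcup_flatten th fP)) !big_flatten !big_map.
rewrite big_seq [leRHS]big_seq; apply: ler_sum => t tts.
apply: IH => //; [exact: thesaurus_child tts | | exact: filter_uniq].
exact: leaf_partition_restrict tts.
Qed.

Lemma freq_root t : {subset S <= leaves t} -> freq S t = size S.
Proof.
by move=> sub; apply/eqP; rewrite -all_count; apply/allP => n /sub; rewrite in_class.
Qed.

(** [L'] counts all nodes of the cut instead of one fewer, which shifts it by half of log |S|
    whatever the cut is. Restricting the data term to leaves of [t] drops nothing, as the whole
    sample lies there. *)
Lemma description_length_cost t (c : {fset tree noun}) :
  {subset S <= leaves t} -> leaf_partition t c ->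
  description_length t S (mle R S c)
    = L_mod R t - log2 (size S)%:R / 2 + \sum_(C <- c) cost C.
Proof.
move=> sub cP; rewrite -(L'_sum_cost cP) /description_length /L_par /L_dat /L'.
rewrite (_ : \sum_(n <- S) _ = \sum_(n <- S | n \in class t)
    log2 (noun_prob (mle R S c) n)); first by rewrite /=; field.
rewrite [LHS]big_seq [RHS]big_seq_cond; apply: eq_bigl => n.
by rewrite in_class; case nS: (n \in S) => //=; rewrite sub.
Qed.

Lemma mle_tree_cut_model t (c : {fset tree noun}) :
  thesaurus t -> S != [::] -> {subset S <= leaves t} -> leaf_partition t c ->
  is_tree_cut_model t (mle R S c).
Proof.
move=> th S0 sub cP; split=> [|C _|]; first exact/is_cutP.
  by rewrite divr_ge0 ?ler0n.
rewrite -mulr_suml -natr_sum (sum_freq cP) freq_root // divff //.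
by rewrite pnatr_eq0 size_eq0.
Qed.

End DescriptionLength.

(** * Closed forms for the results and step counts of the loops *)

Definition delay (A : Type) (k : nat) (m : timed A) : timed A := (m.1, (k + m.2)%N).

(** Unfolding [bind] would duplicate the rest of the program; rewriting with [delay] peels off one
    computed prefix and keeps a single copy. *)
Lemma bind_pair (A B : Type) (x : A) k (f : A -> timed B) :
  bind (x, k) f = delay k (f x).
Proof. by []. Qed.

Lemma map_timedE (A B : Type) (f : A -> timed B) (s : seq A) :
  map_timed f s
    = ([seq result (f x) | x <- s],
       (\sum_(x <- s) time (f x) + (size s).+1)%N).
Proof.
elim: s => [|x s IHs] /=; first by rewrite big_nil.
rewrite IHs big_cons; case: (f x) => y k; rewrite !bind_pair /delay /=.
by congr pair; lia.
Qed.

Lemma size_timedE (A : Type) (s : seq A) : size_timed s = (size s, (size s).+1).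
Proof. by elim: s => //= x s ->; rewrite !bind_pair /delay /= addn1. Qed.

Lemma nseq_timedE (A : Type) k (x : A) : nseq_timed k x = (nseq k x, k.+1).
Proof. by elim: k => //= k ->; rewrite !bind_pair /delay /= addn1. Qed.

Lemma count_timedE (noun : eqType) (n : noun) (s : seq noun) :
  count_timed n s = (count_mem n s, (size s).*2.+1).
Proof.
elim: s => //= m s ->; rewrite !bind_pair /delay /= addn2 doubleS.
by case: (m == n).
Qed.

Lemma sum_log_timedE (R : realType) (ps : seq R) :
  sum_log_timed ps = (\sum_(p <- ps) log2 p, (size ps).*2.+1).
Proof.
elim: ps => [|p ps IHps] /=; first by rewrite big_nil.
by rewrite IHps !bind_pair /delay /= big_cons addn2 doubleS.
Qed.

Lemma L'_timedE (R : realType) (lS : R) k ps :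
  L'_timed lS k ps
    = (k%:R / 2 * lS - \sum_(p <- ps) log2 p, (size ps).*2.+2).
Proof. by rewrite /L'_timed sum_log_timedE !bind_pair /delay /= addn1. Qed.

Lemma append_timedE (R : realType) (noun : Type) (rs : seq (answer R noun)) :
  append_timed rs
    = (Answer (flatten (map (@ans_cut R noun) rs))
              (sumn (map (@ans_size R noun) rs))
              (sumn (map (@ans_leaves R noun) rs))
              (flatten (map (@ans_probs R noun) rs)),
       (5 * size rs).+1).
Proof.
elim: rs => //= r rs ->; rewrite !bind_pair /delay /=.
by congr pair; lia.
Qed.

(** * Correctness and running time of the timed program *)

Section Algorithm.
Variables (R : realType) (noun : choiceType) (S : seq noun).
Implicit Types (t C : tree noun) (ts c : seq (tree noun)).

Let lS : R := log2 (size S)%:R.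
Let visit := visit_timed S (size S) lS.

(** The probabilities come grouped by class, not in the order of [S], because the program
    concatenates the lists of the children. *)
Definition probs c : seq R :=
  flatten [seq nseq (freq S C) (class_prob R S C) | C <- c].

(** The invariant of a call: the cut determines the other fields of the answer. *)
Definition answer_of t c : answer R noun :=
  Answer c (size c) (size (leaves t)) (probs c).

Lemma append_answer_of ts (f : tree noun -> seq (tree noun)) :
  append_timed [seq answer_of t (f t) | t <- ts]
    = (answer_of (Node ts) (flatten (map f ts)), (5 * size ts).+1).
Proof.
rewrite append_timedE size_map -!map_comp; congr pair.
rewrite /answer_of !size_flatten /shape /= -!map_comp; congr Answer.
rewrite /probs map_flatten; elim: ts => //= t ts ->.
by rewrite flatten_cat.
Qed.

(** Justifies how the program finds the frequency of an internal node: it measures the list of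
    probabilities and never scans [S] again. *)
Lemma size_probs t c (c0 : {fset tree noun}) :
  leaf_partition t c0 -> perm_eq c c0 -> size (probs c) = freq S t.
Proof.
move=> c0P cc0; rewrite -(sum_freq S c0P) -(perm_big _ cc0) /=.
rewrite /probs size_flatten /shape -map_comp sumnE big_map.
by apply: eq_bigr => C _ /=; rewrite size_nseq.
Qed.

Lemma card_class t : thesaurus t -> #|` class t| = size (leaves t).
Proof. by case/andP=> U _; rewrite card_fseq undup_id. Qed.

Lemma sum_log_probs c :
  (size c)%:R / 2 * lS - \sum_(p <- probs c) log2 p
    = \sum_(C <- c) cost R S C.
Proof.
rewrite /cost sumrB /probs big_flatten big_map; congr (_ - _).
  by rewrite big_const_seq count_predT iter_addr_0 -[RHS]mulr_natl /lS; ring.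
by apply: eq_bigr => C _; rewrite big_nseq iter_addr_0.
Qed.

Lemma probs_root t : probs [:: t] = nseq (freq S t) (class_prob R S t).
Proof. by rewrite /probs /= cats0. Qed.

Lemma visit_Leaf n :
  visit (Leaf n) = (answer_of (Leaf n) [:: Leaf n],
                    ((size S).*2 + freq S (Leaf n) + 4)%N).
Proof.
have fE : count_mem n S = freq S (Leaf n).
  by apply: eq_count => m; rewrite /= in_class inE.
rewrite /visit /= count_timedE fE !bind_pair nseq_timedE !bind_pair /delay /=.
congr pair; last by lia.
rewrite /answer_of probs_root /class_prob; congr (Answer _ _ _ (nseq _ _)).
(* The program does not divide by the class size at a leaf, where it is 1. *)
by rewrite card_fseq divr1.
Qed.

Lemma visit_Node ts (f : tree noun -> seq (tree noun)) :
  thesaurus (Node ts) ->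
  (forall t, t \in ts -> result (visit t) = answer_of t (f t)) ->
  (forall t, t \in ts -> perm_eq (f t) (find_mdl R S t)) ->
  let c := flatten (map f ts) in
  visit (Node ts)
    = (answer_of (Node ts)
         (if cost R S (Node ts) < \sum_(C <- c) cost R S C
          then [:: Node ts] else c),
       (\sum_(t <- ts) time (visit t)
        + 6 * size ts + 6 * freq S (Node ts) + 11)%N).
Proof.
move=> th res perm c.
have fP t : t \in ts -> leaf_partition t (find_mdl R S t).
  by move=> tts; apply/find_mdl_partition/(thesaurus_child th).
have c_perm : perm_eq c (\bigcup_(t <- ts) find_mdl R S t)%fset.
  exact: perm_flatten_find_mdl.
have size_c := size_probs (leaf_partition_bigfcup th fP) c_perm.
rewrite /visit /= -/visit map_timedE bind_pair.
have -> : [seq result (visit t) | t <- ts] = [seq answer_of t (f t) | t <- ts].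
  exact/eq_in_map.
rewrite append_answer_of bind_pair size_timedE bind_pair /= size_c.
have -> : (freq S (Node ts))%:R / (size S)%:R
            / (size (flatten (map (@leaves noun) ts)))%:R
          = class_prob R S (Node ts) by rewrite /class_prob card_class.
rewrite bind_pair nseq_timedE bind_pair !L'_timedE !bind_pair -probs_root.
rewrite sum_log_probs (sum_log_probs [:: Node ts]) big_seq1 size_c.
rewrite probs_root size_nseq -fun_if.
(* Children: [map_timed] and [append_timed] cost 1 and 5 each. Sample elements: measuring,
   rebuilding and the two evaluations of [L'] cost 1, 1, 2 and 2 each. The rest is 11. *)
rewrite /delay /= -/c; congr pair; last by lia.
by case: ifP => // _; rewrite -probs_root.
Qed.

(** Agreement holds only up to order: the program lists its cut by concatenation, whereas a finite
    set has its own enumeration. *)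
Lemma visit_correct t :
  thesaurus t ->
  result (visit t) = answer_of t (ans_cut (result (visit t)))
  /\ perm_eq (ans_cut (result (visit t))) (find_mdl R S t).
Proof.
elim/tree_ind_in: t => [n | ts IH] th.
  by rewrite visit_Leaf; split=> //=; rewrite fset_seq1.
have fP t : t \in ts -> leaf_partition t (find_mdl R S t).
  by move=> tts; apply/find_mdl_partition/(thesaurus_child th).
have res t (tts : t \in ts) := (IH t tts (thesaurus_child th tts)).1.
have perm t (tts : t \in ts) := (IH t tts (thesaurus_child th tts)).2.
rewrite (visit_Node th res perm) /=; split=> //.
set c := flatten _; rewrite big_map.
have c_perm : perm_eq c (\bigcup_(t <- ts) find_mdl R S t)%fset.
  exact: perm_flatten_find_mdl.
rewrite (L'_sum_cost R S (leaf_partition_fset1 _)) big_seq_fset1.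
rewrite (L'_sum_cost R S (leaf_partition_bigfcup th fP)) -(perm_big _ c_perm) /=.
by case: ifP => // _; rewrite fset_seq1.
Qed.

(* The slack 29 |S| absorbs the work at an internal node: it is paid for by
   the children, of which there are at least two. *)
Lemma visit_time t :
  thesaurus t -> branching t -> S != [::] ->
  (time (visit t) + 29 * size S <= 36 * (size (leaves t) * size S))%N.
Proof.
move=> th br S0; have {}S0 : (0 < size S)%N by rewrite lt0n size_eq0.
elim/tree_ind_in: t th br => [n | ts IH] th br.
  rewrite visit_Leaf /=.
  (* A leaf takes at most 3 |S| + 4 steps, hence at most 7 |S|, and 36 = 7 + 29. *)
  have := count_size (fun m => m \in class (Leaf n)) S.
  by rewrite -/(freq S (Leaf n)); lia.
have res t (tts : t \in ts) := (visit_correct (thesaurus_child th tts)).1.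
have perm t (tts : t \in ts) := (visit_correct (thesaurus_child th tts)).2.
rewrite (visit_Node th res perm) /=.
move: br; rewrite /branching arity_ge_Node => /andP[ts2 /allP br].
have {}IH : (\sum_(t <- ts) (time (visit t) + 29 * size S)
             <= \sum_(t <- ts) 36 * (size (leaves t) * size S))%N.
  rewrite big_seq [leqRHS]big_seq; apply: leq_sum => t tts.
  by apply: IH => //; [exact: thesaurus_child tts | exact: br].
have size_leaves : size (flatten (map (@leaves noun) ts))
                   = (\sum_(t <- ts) size (leaves t))%N.
  by rewrite size_flatten /shape -map_comp sumnE big_map.
move: IH; rewrite big_split /= big_const_seq count_predT iter_addn_0.
rewrite -big_distrr -big_distrl /= -size_leaves.
have := count_size (fun m => m \in class (Node ts)) S.
rewrite -/(freq S (Node ts)); move: (size ts) ts2 => k k2 fS.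
(* This inequality fixes the slack: for k = 2 and |S| = 1 it is an equality, so 29 is the least
   value that works. *)
suff : (6 * k + 6 * size S + 11 + 29 * size S <= 29 * size S * k)%N by lia.
by nia.
Qed.

Lemma find_mdl_timedE T :
  find_mdl_timed R S T
    = (ans_cut (result (visit T)), (size S + time (visit T) + 3)%N).
Proof.
rewrite /find_mdl_timed size_timedE !bind_pair /delay /=; congr pair.
by rewrite /visit /lS /time; lia.
Qed.

End Algorithm.

(** The time bound is conditional on [branching] because a chain of unary nodes adds steps without
    adding leaves. *)
Theorem proposition1 (R : realType) :
  exists K : nat, forall (noun : choiceType) (T : tree noun) (S : seq noun),
    thesaurus T -> S != [::] -> {subset S <= leaves T} ->
    let Gamma := find_mdl R S T in
    [/\ perm_eq (result (find_mdl_timed R S T)) Gamma,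
        branching T ->
          (time (find_mdl_timed R S T) <= K * (size (leaves T) * size S))%N,
        is_tree_cut_model T (mle R S Gamma)
      & forall Gamma' : {fset tree noun}, Gamma' \in cuts T ->
          description_length T S (mle R S Gamma)
            <= description_length T S (mle R S Gamma')].
Proof.
exists 36%N => noun T S th S0 sub Gamma.
have GammaP : leaf_partition T Gamma by apply: find_mdl_partition.
rewrite find_mdl_timedE; split=> /=.
- by have [] := visit_correct R S th.
(* The |S| + 3 steps spent outside the traversal fit into the slack 29 |S|. *)
- move=> br; have := visit_time R th br S0.
  have : (0 < size S)%N by rewrite lt0n size_eq0.
  by move: (time _) => m; lia.
- exact: mle_tree_cut_model.
- move=> Gamma'; rewrite !inE => /andP[_ /(is_cutP _ th) Gamma'P].
  rewrite !description_length_cost // lerD2l.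
  by apply: find_mdl_min => //; apply: fset_uniq.
Qed.
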